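(* Let $(\mathbf c^k)_{k\in\mathbb N}$, $(\tilde{\mathbf c}^k)_{k\in\mathbb N}$ be generated by any one of the seven Lagrangian-based schemes LAG-I, ..., LAG-VII (listed in the context, with the listed conditions on $\mathbf M,\mathbf\Omega,\mathbf\Gamma$), and let $\mathbf c^\star\in\mathrm{zer}\,\mathcal A$ be a saddle point. Then the generalized Bregman distance $\Pi(\cdot,\mathbf c^\star)$ associated with $f(\mathbf x)+g(\mathbf a)$ between the ergodic point $\frac1k\sum_{i=0}^{k-1}\tilde{\mathbf c}^i$ and $\mathbf c^\star$ has a rate of $O(1/k)$: for every $k\ge 1$, $$0\le \Pi\Big(\frac1k\sum_{i=0}^{k-1}\tilde{\mathbf c}^i,\ \mathbf c^\star\Big)\le \frac{1}{2k}\,\big\|\mathbf c^0-\mathbf c^\star\big\|_{\mathcal S}^2 .$$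
   Context: Let $f:\mathbb R^N\to\mathbb R\cup\{+\infty\}$ and $g:\mathbb R^M\to\mathbb R\cup\{+\infty\}$ be proper, lower semicontinuous and convex, and $\mathbf A:\mathbb R^N\to\mathbb R^M$ linear. The Lagrangian is $\mathcal L(\mathbf x,\mathbf a,\mathbf p)=f(\mathbf x)+g(\mathbf a)+\langle\mathbf p,\mathbf A\mathbf x-\mathbf a\rangle$. Write $\mathbf c=(\mathbf x,\mathbf a,\mathbf p)\in\mathbb R^N\times\mathbb R^M\times\mathbb R^M$ and $$\Pi(\mathbf c,\mathbf c')=\mathcal L(\mathbf x,\mathbf a,\mathbf p')-\mathcal L(\mathbf x',\mathbf a',\mathbf p).$$ For $\mathbf c^\star\in\mathrm{zer}\,\mathcal A$ (with $\mathcal A$ below), $\Pi(\mathbf c,\mathbf c^\star)$ is the generalized Bregman distance $q(\mathbf u)-q(\mathbf u^\star)-\langle \mathbf v,\mathbf u-\mathbf u^\star\rangle$ of $q(\mathbf x,\mathbf a)=f(\mathbf x)+g(\mathbf a)$, where $\mathbf u=(\mathbf x,\mathbf a)$, $\mathbf u^\star=(\mathbf x^\star,\mathbf a^\star)$, $\mathbf v=(-\mathbf A^\top\mathbf p^\star,\mathbf p^\star)\in\partial q(\mathbf u^\star)$. $\mathbb S_+$ (resp. $\mathbb S_{++}$) denotes symmetric positive semidefinite (resp. definite) matrices; $X\succ Y$ means $X-Y\in\mathbb S_{++}$; $\|\mathbf c\|_{\mathcal S}^2=\langle\mathbf c,\mathcal S\mathbf c\rangle$; $\mathbf I$ is the identity.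 $\mathbf M$ ($N\times N$), $\mathbf\Omega,\mathbf\Gamma$ ($M\times M$) are symmetric matrices (proximal metrics). Let $$\mathcal A=\begin{bmatrix}\partial f&0&\mathbf A^\top\\0&\partial g&-\mathbf I\\-\mathbf A&\mathbf I&0\end{bmatrix},\qquad \mathrm{zer}\,\mathcal A=\{\mathbf c:0\in\mathcal A\mathbf c\}.$$ Each scheme is a generalized proximal point algorithm $$0\in\mathcal A\tilde{\mathbf c}^k+\mathcal Q(\tilde{\mathbf c}^k-\mathbf c^k),\qquad \mathbf c^{k+1}=\mathbf c^k+\mathcal M(\tilde{\mathbf c}^k-\mathbf c^k),$$ where $\tilde{\mathbf c}^k=(\tilde{\mathbf x}^k,\tilde{\mathbf a}^k,\tilde{\mathbf p}^k)$ is the proximal output, $\mathcal Q,\mathcal M$ are given below, and $\mathcal S=\mathcal Q\mathcal M^{-1}$. Iterates are assumed to exist. Notation for the explicit forms: $P_\varphi(B;\mathbf w)=\arg\min_{\mathbf u}\varphi(\mathbf u)+\frac12\langle\mathbf u,B\mathbf u\rangle-\langle\mathbf w,\mathbf u\rangle$, which equals $\mathrm{prox}_\varphi^{B}(B^{-1}\mathbf w)=\arg\min_{\mathbf u}\varphi(\mathbf u)+\frac12\|\mathbf u-B^{-1}\mathbf w\|_B^2$ when $B$ is invertible. LAG-I: $\mathcal Q=\begin{bmatrix}\mathbf M&0&-\mathbf A^\top\\0&\mathbf\Omega&\mathbf I\\-\mathbf A&\mathbf I&\mathbf\Gamma^{-1}\end{bmatrix}$, $\mathcal M=\mathbf I$;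 i.e. $\mathbf x^{k+1}=P_f(\mathbf M;\mathbf M\mathbf x^k-\mathbf A^\top\mathbf p^k)$, $\mathbf a^{k+1}=P_g(\mathbf\Omega;\mathbf\Omega\mathbf a^k+\mathbf p^k)$, $\mathbf p^{k+1}=\mathbf p^k+\mathbf\Gamma(\mathbf A(2\mathbf x^{k+1}-\mathbf x^k)-(2\mathbf a^{k+1}-\mathbf a^k))$. Condition: $\mathbf M,\mathbf\Omega,\mathbf\Gamma\in\mathbb S_{++}$, $\mathbf\Gamma^{-1}\succ\mathbf A\mathbf M^{-1}\mathbf A^\top+\mathbf\Omega^{-1}$. LAG-II: $\mathcal Q=\begin{bmatrix}\mathbf M&0&0\\0&\mathbf\Omega&-\mathbf I\\0&-\mathbf I&\mathbf\Gamma^{-1}\end{bmatrix}$, $\mathcal M=\mathbf I$; i.e. $\mathbf x^{k+1}=P_f(\mathbf M+\mathbf A^\top\mathbf\Gamma\mathbf A;\mathbf M\mathbf x^k+\mathbf A^\top\mathbf\Gamma\mathbf a^k-\mathbf A^\top\mathbf p^k)$, $\mathbf p^{k+1}=\mathbf p^k+\mathbf\Gamma(\mathbf A\mathbf x^{k+1}-\mathbf a^k)$, $\mathbf a^{k+1}=P_g(\mathbf\Omega;\mathbf\Omega\mathbf a^k+2\mathbf p^{k+1}-\mathbf p^k)$. Condition: $\mathbf M\in\mathbb S_+$, $\mathbf\Omega,\mathbf\Gamma\in\mathbb S_{++}$, $\mathbf\Omega\succ\mathbf\Gamma$. LAG-III: $\mathcal Q=\begin{bmatrix}\mathbf M&0&0\\0&\mathbf\Omega&\mathbf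 I\\0&0&\mathbf\Gamma^{-1}\end{bmatrix}$, $\mathcal M=\begin{bmatrix}\mathbf I&0&0\\0&\mathbf I&0\\0&-\mathbf\Gamma&\mathbf I\end{bmatrix}$; i.e. $\mathbf a^{k+1}=P_g(\mathbf\Omega;\mathbf\Omega\mathbf a^k+\mathbf p^k)$, $\mathbf x^{k+1}=P_f(\mathbf M+\mathbf A^\top\mathbf\Gamma\mathbf A;\mathbf M\mathbf x^k-\mathbf A^\top\mathbf p^k+\mathbf A^\top\mathbf\Gamma\mathbf a^{k+1})$, $\mathbf p^{k+1}=\mathbf p^k+\mathbf\Gamma(\mathbf A\mathbf x^{k+1}+\mathbf a^k-2\mathbf a^{k+1})$. Condition: same as LAG-II. LAG-IV: $\mathcal Q=\begin{bmatrix}\mathbf M&0&-\mathbf A^\top\\0&\mathbf\Omega&0\\0&0&\mathbf\Gamma^{-1}\end{bmatrix}$, $\mathcal M=\begin{bmatrix}\mathbf I&0&0\\0&\mathbf I&0\\\mathbf\Gamma\mathbf A&0&\mathbf I\end{bmatrix}$; i.e. $\mathbf x^{k+1}=P_f(\mathbf M;\mathbf M\mathbf x^k-\mathbf A^\top\mathbf p^k)$, $\mathbf a^{k+1}=P_g(\mathbf\Omega+\mathbf\Gamma;\mathbf\Omega\mathbf a^k+\mathbf\Gamma\mathbf A\mathbf x^{k+1}+\mathbf p^k)$, $\mathbf p^{k+1}=\mathbf p^k+\mathbf\Gamma(\mathbf A(2\mathbf x^{k+1}-\mathbf x^k)-\mathbf a^{k+1})$. Condition: $\mathbf M,\mathbf\Gamma\in\mathbb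 S_{++}$, $\mathbf\Omega\in\mathbb S_+$, $\mathbf M\succ\mathbf A^\top\mathbf\Gamma\mathbf A$. LAG-V: $\mathcal Q=\begin{bmatrix}\mathbf M+\mathbf A^\top\mathbf\Gamma\mathbf A&0&0\\0&\mathbf\Omega+\mathbf\Gamma&0\\\mathbf A&-\mathbf I&\mathbf\Gamma^{-1}\end{bmatrix}$, $\mathcal M=\begin{bmatrix}\mathbf I&0&0\\0&\mathbf I&0\\\mathbf\Gamma\mathbf A&-\mathbf\Gamma&\mathbf I\end{bmatrix}$; i.e. $\mathbf x^{k+1}=P_f(\mathbf M+\mathbf A^\top\mathbf\Gamma\mathbf A;\mathbf M\mathbf x^k+\mathbf A^\top\mathbf\Gamma\mathbf a^k-\mathbf A^\top\mathbf p^k)$, $\mathbf a^{k+1}=P_g(\mathbf\Omega+\mathbf\Gamma;\mathbf\Omega\mathbf a^k+\mathbf\Gamma\mathbf A\mathbf x^k+\mathbf p^k)$, $\mathbf p^{k+1}=\mathbf p^k+\mathbf\Gamma(\mathbf A\mathbf x^{k+1}-\mathbf a^{k+1})$. Condition: $\mathbf M,\mathbf\Omega,\mathbf\Gamma\in\mathbb S_{++}$, $\mathbf M\succ\mathbf A^\top\mathbf\Gamma\mathbf\Omega^{-1}\mathbf\Gamma\mathbf A$. LAG-VI: $\mathcal Q=\begin{bmatrix}\mathbf M&0&0\\0&\mathbf\Omega+\mathbf\Gamma&0\\0&-\mathbf I&\mathbf\Gamma^{-1}\end{bmatrix}$, $\mathcal M=\begin{bmatrix}\mathbf I&0&0\\0&\mathbf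 I&0\\0&-\mathbf\Gamma&\mathbf I\end{bmatrix}$; i.e. $\mathbf x^{k+1}=P_f(\mathbf M+\mathbf A^\top\mathbf\Gamma\mathbf A;\mathbf M\mathbf x^k+\mathbf A^\top\mathbf\Gamma\mathbf a^k-\mathbf A^\top\mathbf p^k)$, $\mathbf a^{k+1}=P_g(\mathbf\Omega+\mathbf\Gamma;\mathbf\Omega\mathbf a^k+\mathbf\Gamma\mathbf A\mathbf x^{k+1}+\mathbf p^k)$, $\mathbf p^{k+1}=\mathbf p^k+\mathbf\Gamma(\mathbf A\mathbf x^{k+1}-\mathbf a^{k+1})$. Condition: $\mathbf M,\mathbf\Omega\in\mathbb S_+$, $\mathbf\Gamma\in\mathbb S_{++}$. LAG-VII: $\mathcal Q=\begin{bmatrix}\mathbf M&0&-\mathbf A^\top\\0&\mathbf\Omega&\mathbf I\\\mathbf A&-\mathbf I&\mathbf\Gamma^{-1}\end{bmatrix}$, $\mathcal M=\begin{bmatrix}\mathbf I&0&-\mathbf M^{-1}\mathbf A^\top\\0&\mathbf I&\mathbf\Omega^{-1}\\\mathbf\Gamma\mathbf A&-\mathbf\Gamma&\mathbf I\end{bmatrix}$; i.e. $\tilde{\mathbf x}^k=P_f(\mathbf M;\mathbf M\mathbf x^k-\mathbf A^\top\mathbf p^k)$, $\tilde{\mathbf a}^k=P_g(\mathbf\Omega;\mathbf\Omega\mathbf a^k+\mathbf p^k)$, $\mathbf x^{k+1}=\tilde{\mathbf x}^k-\mathbf M^{-1}\mathbf A^\top\mathbf\Gamma(\mathbf A\mathbf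 x^k-\mathbf a^k)$, $\mathbf a^{k+1}=\tilde{\mathbf a}^k+\mathbf\Omega^{-1}\mathbf\Gamma(\mathbf A\mathbf x^k-\mathbf a^k)$, $\mathbf p^{k+1}=\mathbf p^k+\mathbf\Gamma(\mathbf A\tilde{\mathbf x}^k-\tilde{\mathbf a}^k)$. Condition: $\mathbf M,\mathbf\Omega,\mathbf\Gamma\in\mathbb S_{++}$, $\mathbf\Gamma^{-1}\succ\mathbf A\mathbf M^{-1}\mathbf A^\top+\mathbf\Omega^{-1}$. *)

(* Defs.v *)
From HB Require Import structures.
From mathcomp Require Import all_boot all_order all_algebra.
From mathcomp Require Import all_classical all_reals all_analysis.

Set Implicit Arguments.
Unset Strict Implicit.
Unset Printing Implicit Defensive.

Import Order.TTheory GRing.Theory Num.Theory.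
Import numFieldNormedType.Exports.

Local Open Scope classical_set_scope.
Local Open Scope ring_scope.

Section matrices.
Context {R : realType}.

Definition dot n (u v : 'cV[R]_n) : R := \sum_(i < n) u i 0 * v i 0.

Definition psd n (X : 'M[R]_n) : Prop :=
  X^T = X /\ forall u : 'cV[R]_n, 0 <= dot u (X *m u).

Definition pd n (X : 'M[R]_n) : Prop :=
  X^T = X /\ forall u : 'cV[R]_n, u != 0 -> 0 < dot u (X *m u).

(* X \succ Y in the Loewner order. *)
Definition loewner_gt n (X Y : 'M[R]_n) : Prop := pd (X - Y).

Definition snorm2 n (S : 'M[R]_n) (c : 'cV[R]_n) : R := dot c (S *m c).

Definition block3 n m (B11 : 'M[R]_n) (B12 B13 : 'M[R]_(n, m))
    (B21 : 'M[R]_(m, n)) (B22 B23 : 'M[R]_m)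
    (B31 : 'M[R]_(m, n)) (B32 B33 : 'M[R]_m) : 'M[R]_(n + (m + m)) :=
  block_mx B11 (row_mx B12 B13)
           (col_mx B21 B31) (block_mx B22 B23 B32 B33).

(* The components of c = (x, a, p). *)
Definition triple n m (x : 'cV[R]_n) (a p : 'cV[R]_m) : 'cV[R]_(n + (m + m)) :=
  col_mx x (col_mx a p).
Definition xpart n m (c : 'cV[R]_(n + (m + m))) : 'cV[R]_n := usubmx c.
Definition apart n m (c : 'cV[R]_(n + (m + m))) : 'cV[R]_m := usubmx (dsubmx c).
Definition ppart n m (c : 'cV[R]_(n + (m + m))) : 'cV[R]_m := dsubmx (dsubmx c).

End matrices.

Section convex_analysis.
Context {R : realType} {n : nat}.
Implicit Types (phi : 'cV[R]_n -> \bar R).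
Local Open Scope ereal_scope.

Definition proper phi : Prop :=
  (forall x, phi x != -oo) /\ (exists x, phi x != +oo).

(* [0 * +oo = 0] in [\bar R], so the endpoints t = 0, 1 are harmless; for a
   proper phi no [+oo - oo] can occur. *)
Definition convex_efun phi : Prop :=
  forall (x y : 'cV[R]_n) (t : R), (0 <= t <= 1)%R ->
    phi (t *: x + (1 - t) *: y)%R <= t%:E * phi x + (1 - t)%:E * phi y.

Definition proper_lsc_convex phi : Prop :=
  [/\ proper phi, lower_semicontinuous phi & convex_efun phi].

(* For a proper phi this is empty outside the domain of phi: if
   [phi x = +oo], a point y with [phi y < +oo] violates the inequality. *)
Definition subdiff phi (x : 'cV[R]_n) : set 'cV[R]_n :=
  [set v | forall y, phi x + (dot v (y - x))%:E <= phi y].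

Definition argmin phi : set 'cV[R]_n :=
  [set u | forall v, phi u <= phi v].

(* [proxP phi B w] is the set of minimisers of phi + 1/2 <., B .> - <w, .>; it
   need not be a singleton when B is singular. *)
Definition proxP phi (B : 'M[R]_n) (w : 'cV[R]_n) : set 'cV[R]_n :=
  argmin (fun u => phi u + (2^-1 * dot u (B *m u) - dot w u)%:E).

End convex_analysis.

Section lagrangian.
Context {R : realType} {n m : nat}.
Variables (f : 'cV[R]_n -> \bar R) (g : 'cV[R]_m -> \bar R) (A : 'M[R]_(m, n)).

Definition lagrangian (x : 'cV[R]_n) (a p : 'cV[R]_m) : \bar R :=
  (f x + g a + (dot p (A *m x - a))%:E)%E.

Definition Pi (c c' : 'cV[R]_(n + (m + m))) : \bar R :=
  (lagrangian (xpart c) (apart c) (ppart c')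
   - lagrangian (xpart c') (apart c') (ppart c))%E.

Definition calA (c : 'cV[R]_(n + (m + m))) : set 'cV[R]_(n + (m + m)) :=
  [set v | exists s t, [/\ subdiff f (xpart c) s, subdiff g (apart c) t &
     v = triple (s + A^T *m ppart c) (t - ppart c)
                (- (A *m xpart c) + apart c)]].

Definition zerA : set 'cV[R]_(n + (m + m)) := [set c | calA c 0].

End lagrangian.

Inductive lag_scheme :=
  | LAG_I | LAG_II | LAG_III | LAG_IV | LAG_V | LAG_VI | LAG_VII.

Section schemes.
Context {R : realType} {n m : nat}.
Variables (s : lag_scheme) (A : 'M[R]_(m, n)).
Variables (M : 'M[R]_n) (Om Ga : 'M[R]_m).

Definition lag_cond : Prop :=
  match s with
  | LAG_I | LAG_VII =>
      [/\ pd M, pd Om, pd Ga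
        & loewner_gt (invmx Ga) (A *m invmx M *m A^T + invmx Om)]
  | LAG_II | LAG_III =>
      [/\ psd M, pd Om, pd Ga & loewner_gt Om Ga]
  | LAG_IV =>
      [/\ pd M, pd Ga, psd Om & loewner_gt M (A^T *m Ga *m A)]
  | LAG_V =>
      [/\ pd M, pd Om, pd Ga
        & loewner_gt M (A^T *m Ga *m invmx Om *m Ga *m A)]
  | LAG_VI => [/\ psd M, psd Om & pd Ga]
  end.

Definition calQ : 'M[R]_(n + (m + m)) :=
  match s with
  | LAG_I   => block3 M     0     (- A^T)
                      0     Om    1%:M
                      (- A) 1%:M  (invmx Ga)
  | LAG_II  => block3 M     0         0
                      0     Om        (- 1%:M)
                      0     (- 1%:M)  (invmx Ga)
  | LAG_III => block3 M     0     0
                      0     Om    1%:M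
                      0     0     (invmx Ga)
  | LAG_IV  => block3 M     0     (- A^T)
                      0     Om    0
                      0     0     (invmx Ga)
  | LAG_V   => block3 (M + A^T *m Ga *m A)  0          0
                      0                     (Om + Ga)  0
                      A                     (- 1%:M)   (invmx Ga)
  | LAG_VI  => block3 M     0          0
                      0     (Om + Ga)  0
                      0     (- 1%:M)   (invmx Ga)
  | LAG_VII => block3 M     0         (- A^T)
                      0     Om        1%:M
                      A     (- 1%:M)  (invmx Ga)
  end.

Definition calM : 'M[R]_(n + (m + m)) :=
  match s with
  | LAG_I | LAG_II => 1%:M
  | LAG_III | LAG_VI =>
      block3 1%:M  0       0
             0     1%:M    0
             0     (- Ga)  1%:M
  | LAG_IV =>
      block3 1%:M       0     0
             0          1%:M  0
             (Ga *m A)  0     1%:M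
  | LAG_V =>
      block3 1%:M       0       0
             0          1%:M    0
             (Ga *m A)  (- Ga)  1%:M
  | LAG_VII =>
      block3 1%:M       0       (- (invmx M *m A^T))
             0          1%:M    (invmx Om)
             (Ga *m A)  (- Ga)  1%:M
  end.

(* [calM] is invertible under [lag_cond], so [invmx] is the actual inverse. *)
Definition calS : 'M[R]_(n + (m + m)) := calQ *m invmx calM.

Variables (f : 'cV[R]_n -> \bar R) (g : 'cV[R]_m -> \bar R).

Definition relaxation (c ct c' : 'cV[R]_(n + (m + m))) : Prop :=
  c' = c + calM *m (ct - c).

Definition gppa_step (c ct c' : 'cV[R]_(n + (m + m))) : Prop :=
  (exists2 v, calA f g A ct v & v + calQ *m (ct - c) = 0) /\
  relaxation c ct c'.

(* The proximal update formulas of each scheme, with (x, a, p) the current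
   iterate, (xt, at_, _) the proximal output and (x', a', p') the next iterate.
   Only the last scheme names components of the proximal output. *)
Definition lag_update (c ct c' : 'cV[R]_(n + (m + m))) : Prop :=
  let x := xpart c in let a := apart c in let p := ppart c in
  let xt := xpart ct in let at_ := apart ct in
  let x' := xpart c' in let a' := apart c' in let p' := ppart c' in
  let MA := M + A^T *m Ga *m A in
  match s with
  | LAG_I =>
      [/\ proxP f M (M *m x - A^T *m p) x',
          proxP g Om (Om *m a + p) a'
        & p' = p + Ga *m (A *m (2 *: x' - x) - (2 *: a' - a))]
  | LAG_II =>
      [/\ proxP f MA (M *m x + A^T *m Ga *m a - A^T *m p) x',
          p' = p + Ga *m (A *m x' - a)
        & proxP g Om (Om *m a + 2 *: p' - p) a']
  | LAG_III =>
      [/\ proxP g Om (Om *m a + p) a',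
          proxP f MA (M *m x - A^T *m p + A^T *m Ga *m a') x'
        & p' = p + Ga *m (A *m x' + a - 2 *: a')]
  | LAG_IV =>
      [/\ proxP f M (M *m x - A^T *m p) x',
          proxP g (Om + Ga) (Om *m a + Ga *m A *m x' + p) a'
        & p' = p + Ga *m (A *m (2 *: x' - x) - a')]
  | LAG_V =>
      [/\ proxP f MA (M *m x + A^T *m Ga *m a - A^T *m p) x',
          proxP g (Om + Ga) (Om *m a + Ga *m A *m x + p) a'
        & p' = p + Ga *m (A *m x' - a')]
  | LAG_VI =>
      [/\ proxP f MA (M *m x + A^T *m Ga *m a - A^T *m p) x',
          proxP g (Om + Ga) (Om *m a + Ga *m A *m x' + p) a'
        & p' = p + Ga *m (A *m x' - a')]
  | LAG_VII =>
      [/\ proxP f M (M *m x - A^T *m p) xt,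
          proxP g Om (Om *m a + p) at_,
          x' = xt - invmx M *m A^T *m Ga *m (A *m x - a),
          a' = at_ + invmx Om *m Ga *m (A *m x - a)
        & p' = p + Ga *m (A *m xt - at_)]
  end.

(* The update formulas do not mention all components of the proximal output;
   the relaxation identity recovers ct, since calM is invertible. *)
Definition explicit_step (c ct c' : 'cV[R]_(n + (m + m))) : Prop :=
  lag_update c ct c' /\ relaxation c ct c'.

(* The iterates may be produced either as a generalised proximal point
   algorithm or by the explicit proximal update formulas. *)
Definition generated_by (c ct : nat -> 'cV[R]_(n + (m + m))) : Prop :=
  (forall k, gppa_step (c k) (ct k) (c k.+1)) \/
  (forall k, explicit_step (c k) (ct k) (c k.+1)).

End schemes.

Definition ergodic {R : realType} {d : nat} (ct : nat -> 'cV[R]_d) (k : nat) :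
    'cV[R]_d :=
  k%:R^-1 *: \sum_(0 <= i < k) ct i.

(* Main.v *)
(* Write S = Q P^-1 for the relaxation matrix P (calM). Each scheme comes down
   to three facts: P is invertible, P^T Q is symmetric positive semidefinite,
   and so is Q + Q^T - P^T Q; both semidefiniteness claims are sums of
   instances of 0 <= <w, Y w> + 2 <w, b> + <b, Y^-1 b>. They give the descent
   estimate <Q (c - ct), ct - cs> <= (|c - cs|_S^2 - |c' - cs|_S^2) / 2 at the
   saddle point cs, whose left-hand side dominates Pi(ct, cs) by the
   subgradient inequalities. Telescoping and Jensen's inequality for f and g
   yield the upper bound; the lower bound is the subgradient inequality at cs.
   *)
Require Import Defs.
From HB Require Import structures.
From mathcomp Require Import all_boot all_order all_algebra.
From mathcomp Require Import all_classical all_reals all_analysis.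
From mathcomp Require Import ring lra.

Set Implicit Arguments.
Unset Strict Implicit.
Unset Printing Implicit Defensive.

Import Order.TTheory GRing.Theory Num.Theory.
Import numFieldNormedType.Exports.

Local Open Scope ring_scope.

(** * Scalar product and adjoints *)

Section dot.
Context {R : realType}.

Lemma dotC n (u v : 'cV[R]_n) : dot u v = dot v u.
Proof. by apply: eq_bigr => i _; rewrite mulrC. Qed.

Lemma dotDr n (u v w : 'cV[R]_n) : dot u (v + w) = dot u v + dot u w.
Proof. by rewrite -big_split; apply: eq_bigr => i _; rewrite mxE mulrDr. Qed.

Lemma dotDl n (u v w : 'cV[R]_n) : dot (u + v) w = dot u w + dot v w.
Proof. by rewrite dotC dotDr !(dotC w). Qed.

Lemma dotZr n a (u v : 'cV[R]_n) : dot u (a *: v) = a * dot u v.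
Proof. by rewrite mulr_sumr; apply: eq_bigr => i _; rewrite mxE mulrCA. Qed.

Lemma dotZl n a (u v : 'cV[R]_n) : dot (a *: u) v = a * dot u v.
Proof. by rewrite dotC dotZr dotC. Qed.

Lemma dotNr n (u v : 'cV[R]_n) : dot u (- v) = - dot u v.
Proof. by rewrite -scaleN1r dotZr mulN1r. Qed.

Lemma dotNl n (u v : 'cV[R]_n) : dot (- u) v = - dot u v.
Proof. by rewrite dotC dotNr dotC. Qed.

Lemma dot0r n (u : 'cV[R]_n) : dot u 0 = 0.
Proof. by rewrite -(scale0r 0) dotZr mul0r. Qed.

Definition dotE := (dotDl, dotDr, dotNl, dotNr).

Lemma dot_mulmxl n m (X : 'M[R]_(n, m)) u v : dot (X *m u) v = dot u (X^T *m v).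
Proof.
have dE k (w z : 'cV[R]_k) : dot w z = (w^T *m z) 0 0.
  by rewrite mxE; apply: eq_bigr => i _; rewrite mxE.
by rewrite !dE trmx_mul mulmxA.
Qed.

Lemma dot_triple n m (x x' : 'cV[R]_n) (a p a' p' : 'cV[R]_m) :
  dot (triple x a p) (triple x' a' p') = dot x x' + dot a a' + dot p p'.
Proof.
by rewrite /dot /triple !big_split_ord /= addrA; congr (_ + _ + _);
  apply: eq_bigr => i _; rewrite ?col_mxEd ?col_mxEu.
Qed.

End dot.

(** * Block vectors (x, a, p) and 3 by 3 block matrices *)

Section triple.
Context {R : realType} {n m : nat}.
Implicit Types (x y : 'cV[R]_n) (a b p q : 'cV[R]_m) (c : 'cV[R]_(n + (m + m))).

Lemma xpart_triple x a p : xpart (triple x a p) = x.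
Proof. exact: col_mxKu. Qed.

Lemma apart_triple x a p : apart (triple x a p) = a.
Proof. by rewrite /apart col_mxKd col_mxKu. Qed.

Lemma ppart_triple x a p : ppart (triple x a p) = p.
Proof. by rewrite /ppart !col_mxKd. Qed.

Lemma triple_parts c : triple (xpart c) (apart c) (ppart c) = c.
Proof. by rewrite /triple !vsubmxK. Qed.

Lemma tripleD x y a b p q :
  triple x a p + triple y b q = triple (x + y) (a + b) (p + q).
Proof. by rewrite /triple !add_col_mx. Qed.

Lemma tripleN x a p : - triple x a p = triple (- x) (- a) (- p).
Proof. by rewrite /triple !opp_col_mx. Qed.

Lemma triple0 : triple 0 0 0 = 0 :> 'cV[R]_(n + (m + m)).
Proof. by rewrite /triple !col_mx0. Qed.

Lemma triple_inj x y a b p q :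
  triple x a p = triple y b q -> [/\ x = y, a = b & p = q].
Proof. by move=> /eq_col_mx[-> /eq_col_mx[-> ->]]. Qed.

Lemma block3_triple (B11 : 'M[R]_n) (B12 B13 : 'M[R]_(n, m))
    (B21 : 'M[R]_(m, n)) (B22 B23 : 'M[R]_m)
    (B31 : 'M[R]_(m, n)) (B32 B33 : 'M[R]_m) x a p :
  block3 B11 B12 B13 B21 B22 B23 B31 B32 B33 *m triple x a p =
  triple (B11 *m x + (B12 *m a + B13 *m p))
         (B21 *m x + (B22 *m a + B23 *m p))
         (B31 *m x + (B32 *m a + B33 *m p)).
Proof.
by rewrite /block3 /triple mul_block_col mul_row_col mul_block_col mul_col_mx
  add_col_mx.
Qed.

Lemma xpart_ergodic (ct : nat -> 'cV[R]_(n + (m + m))) k :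
  xpart (ergodic ct k) = ergodic (fun i => xpart (ct i)) k.
Proof.
apply/matrixP => i j; rewrite !mxE !summxE; congr (_ * _).
by apply: eq_bigr => l _; rewrite mxE.
Qed.

Lemma apart_ergodic (ct : nat -> 'cV[R]_(n + (m + m))) k :
  apart (ergodic ct k) = ergodic (fun i => apart (ct i)) k.
Proof.
apply/matrixP => i j; rewrite !mxE !summxE; congr (_ * _).
by apply: eq_bigr => l _; rewrite !mxE.
Qed.

End triple.

(** * Definite matrices and the Young inequality *)

Section definite.
Context {R : realType}.

Lemma unitmx_ker0 d (X : 'M[R]_d) :
  (forall u : 'cV[R]_d, X *m u = 0 -> u = 0) -> X \in unitmx.
Proof.
move=> X0; rewrite -unitmx_tr unitmxE unitfE; apply/det0P => -[v v0 vX].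
case/eqP: v0; apply: trmx_inj; rewrite trmx0; apply: X0.
by apply: trmx_inj; rewrite trmx_mul trmxK vX trmx0.
Qed.

Lemma pd_psd d (X : 'M[R]_d) : pd X -> psd X.
Proof.
case=> sX pX; split => // u; have [->|/pX/ltW//] := eqVneq u 0.
by rewrite mulmx0 dot0r.
Qed.

Lemma pd_unit d (X : 'M[R]_d) : pd X -> X \in unitmx.
Proof.
case=> _ pX; apply: unitmx_ker0 => u Xu; apply/eqP; apply: contraT => /pX.
by rewrite Xu dot0r ltxx.
Qed.

Lemma pd_invmx d (X : 'M[R]_d) : pd X -> psd (invmx X).
Proof.
move=> Xpd; have uX := pd_unit Xpd; have [sX pX] := pd_psd Xpd.
split=> [|u]; first by rewrite trmx_inv sX.
by rewrite -{1}(mulKVmx uX u) dot_mulmxl sX; apply: pX.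
Qed.

(* The form is [dot z (Y *m z)] at [z = w + invmx Y *m b]. *)
Lemma young_pd d (Y : 'M[R]_d) (w b : 'cV[R]_d) : pd Y ->
  0 <= dot w (Y *m w) + 2 * dot w b + dot b (invmx Y *m b).
Proof.
move=> Ypd; have uY := pd_unit Ypd; have [sY pY] := pd_psd Ypd.
have := pY (w + invmx Y *m b).
rewrite mulmxDr mulKVmx // !dotE [dot (_ *m b) b]dotC [dot (_ *m b) _]dotC.
by rewrite dot_mulmxl sY mulKVmx //; lra.
Qed.

End definite.

(* With [S = Q P^-1], these are the symmetry and nonnegativity of [P^T S P] and
   the nonnegativity of [Q + Q^T - P^T S P]. *)
Definition prediction_correction {R : realType} d (Q P : 'M[R]_d) : Prop :=
  [/\ P \in unitmx,
      forall u v : 'cV[R]_d, dot (P *m u) (Q *m v) = dot (Q *m u) (P *m v),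
      forall u : 'cV[R]_d, 0 <= dot (P *m u) (Q *m u)
    & forall u : 'cV[R]_d, dot (P *m u) (Q *m u) <= 2 * dot u (Q *m u)].

(** * Descent of the S-norm for an abstract pair (Q, P) *)

Section prediction_correction.
Context {R : realType} {d : nat}.
Variables Q P : 'M[R]_d.
Hypothesis QP : prediction_correction Q P.

(** Writing [c = P w] turns the S-form of [c] into <P w, Q w>. *)
Lemma snorm2_ge0 (c : 'cV[R]_d) : 0 <= snorm2 (Q *m invmx P) c.
Proof.
case: QP => uP _ pP _; rewrite /snorm2 -mulmxA -{1}(mulKVmx uP c); exact: pP.
Qed.

(** Put [c - cs = P w] and [e = ct - c], so that [c' - cs = P (w + e)]. By symmetry the terms mixing
    [w] and [e] cancel, and what remains is <P e, Q e> <= 2 <e, Q e>. *)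
Lemma snorm2_descent (c ct c' cs : 'cV[R]_d) : c' = c + P *m (ct - c) ->
  dot (- (Q *m (ct - c))) (ct - cs) <=
  2^-1 * (snorm2 (Q *m invmx P) (c - cs) - snorm2 (Q *m invmx P) (c' - cs)).
Proof.
case: QP => uP sP pP lP ->.
have [w cE] : exists w, c - cs = P *m w.
  by exists (invmx P *m (c - cs)); rewrite mulKVmx.
have -> : ct - cs = (ct - c) + P *m w by rewrite -cE addrA subrK.
move: (ct - c) => e.
have -> : c + P *m e - cs = P *m (w + e) by rewrite mulmxDr -cE addrAC.
rewrite cE /snorm2 -!mulmxA !(mulKmx uP) !mulmxDr !dotE.
rewrite [dot (Q *m e) e]dotC (sP w e) (sP e w) [dot (Q *m w) _]dotC -(sP e w).
by have := lP e; lra.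
Qed.

End prediction_correction.

(** * Verification of the matrix conditions for the seven schemes *)

Section schemes.
Context {R : realType} {n m : nat}.
Variables (A : 'M[R]_(m, n)) (M : 'M[R]_n) (Om Ga : 'M[R]_m).

Lemma lag_cond_psd s : lag_cond s A M Om Ga -> [/\ psd M, psd Om & pd Ga].
Proof. by case: s => -[] *; split=> //; apply: pd_psd. Qed.

Lemma lag_cond_prediction_correction s :
  lag_cond s A M Om Ga ->
  prediction_correction (calQ s A M Om Ga) (calM s A M Om Ga).
Proof.
have ker3 (X : 'M[R]_(n + (m + m))) :
    (forall x a p, X *m triple x a p = 0 -> [/\ x = 0, a = 0 & p = 0]) ->
    X \in unitmx.
  move=> X0; apply: unitmx_ker0 => u; rewrite -(triple_parts u).
  by case/X0 => -> -> ->; apply: triple0.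
have forms3 (Q P : 'M[R]_(n + (m + m))) :
    P \in unitmx ->
    (forall (x y : 'cV[R]_n) (a b p q : 'cV[R]_m),
      dot (P *m triple x a p) (Q *m triple y b q)
        = dot (Q *m triple x a p) (P *m triple y b q)) ->
    (forall (x : 'cV[R]_n) (a p : 'cV[R]_m), let u := triple x a p in
      0 <= dot (P *m u) (Q *m u) /\
      dot (P *m u) (Q *m u) <= 2 * dot u (Q *m u)) ->
    prediction_correction Q P.
  move=> uP sP pP; split=> // [u v|u|u].
  - by rewrite -(triple_parts u) -(triple_parts v); apply: sP.
  - by rewrite -(triple_parts u); apply: (pP _ _ _).1.
  - by rewrite -(triple_parts u); apply: (pP _ _ _).2.
(* These rewrite rules, with [nf], [AT] and [GaA] below, bring every form to a linear combination of
   scalar products in a fixed orientation, which then serve as atoms for [ring] and [lra]. *)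
have simp3 := (@block3_triple R n m, @dot_triple R, @mul0mx R, @mul1mx R,
  @mulNmx R, @add0r, @addr0).
have expand := (@mulmxDl R, @mulmxDr R, @mulNmx R, @mulmxN R, @dotDl R,
  @dotDr R, @dotNl R, @dotNr R).
have AT (x : 'cV[R]_n) (p : 'cV[R]_m) : dot x (A^T *m p) = dot p (A *m x).
  by rewrite dotC dot_mulmxl trmxK.
move=> cond.
have [[sM pM] [sOm pOm] Gapd] := lag_cond_psd cond.
have [sGai pGai] := pd_invmx Gapd; have [sGa pGa] := pd_psd Gapd.
have uGa := pd_unit Gapd.
have nf := (trmxK A, sM, sOm, sGa, sGai, @mulKmx _ _ 1 _ uGa,
  @mulKVmx _ _ 1 _ uGa).
have GaA (x : 'cV[R]_n) (a : 'cV[R]_m) :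
    dot x (A^T *m (Ga *m a)) = dot a (Ga *m (A *m x)).
  by rewrite dotC !dot_mulmxl trmxK sGa.
case: s cond => /=.
- case=> Mpd Ompd _ Cpd.
  apply: forms3 => [|x y a b p q|x a p /=]; first exact: unitmx1.
    by rewrite !simp3 !expand -?mulmxA !dot_mulmxl ?nf; ring.
  (* Since [P = 1], both bounds say that Q is nonnegative. Completing squares in [x] and [a] leaves
     in [p] the Schur complement, nonnegative by [Cpd]. *)
  have := young_pd x (- (A^T *m p)) Mpd; have := young_pd a p Ompd.
  have [_ /(_ p)] := pd_psd Cpd.
  rewrite !simp3 !expand -?mulmxA !dot_mulmxl ?nf AT [dot p a]dotC.
  by move=> *; split; lra.
- case=> _ _ _ Cpd.
  apply: forms3 => [|x y a b p q|x a p /=]; first exact: unitmx1.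
    by rewrite !simp3 !expand -?mulmxA !dot_mulmxl ?nf; ring.
  (* Split [Om] as [(Om - Ga) + Ga]; the second summand absorbs the coupling of [a] and [p]. *)
  have [_ /(_ a)] := pd_psd Cpd; have := young_pd a (- p) Gapd; have := pM x.
  rewrite !simp3 !expand [dot p a]dotC.
  by move=> *; split; lra.
- case=> _ _ _ Cpd.
  apply: forms3 => [|x y a b p q|x a p /=].
  + apply: ker3 => x a p; rewrite !simp3 -triple0 => /triple_inj[-> ->].
    by rewrite mulmx0 oppr0 add0r => ->.
  + by rewrite !simp3 !expand -?mulmxA !dot_mulmxl ?nf; ring.
  (* Here P^T Q is block diagonal, with blocks [M], [Om], [invmx Ga]. The upper bound again uses the
     splitting of [Om]. *)
  + have [_ /(_ a)] := pd_psd Cpd; have := young_pd a p Gapd; have := pM x.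
    have := pGai p; have := pOm a.
    rewrite !simp3 !expand -?mulmxA !dot_mulmxl ?nf.
    by move=> *; split; lra.
- case=> _ _ _ Cpd.
  apply: forms3 => [|x y a b p q|x a p /=].
  + apply: ker3 => x a p; rewrite !simp3 -triple0 => /triple_inj[-> ->].
    by rewrite mulmx0 add0r => ->.
  + by rewrite !simp3 !expand -?mulmxA !dot_mulmxl ?nf; ring.
  (* P^T Q is again diag([M], [Om], [invmx Ga]). In the upper bound the coupling of [A *m x] and [p]
     is absorbed by the part [A^T *m Ga *m A] of [M]. *)
  + have [_ /(_ x)] := pd_psd Cpd; have := young_pd (A *m x) (- p) Gapd.
    have := pGai p; have := pOm a; have := pM x.
    rewrite !simp3 !expand -?mulmxA !dot_mulmxl ?nf.
    by move=> *; split; lra.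
- case=> _ Ompd _ Cpd.
  apply: forms3 => [|x y a b p q|x a p /=].
  + apply: ker3 => x a p; rewrite !simp3 -triple0 => /triple_inj[-> ->].
    by rewrite !mulmx0 oppr0 !add0r => ->.
  + by rewrite !simp3 !expand -?mulmxA !dot_mulmxl ?nf; ring.
  (* The square in [A *m x - a] and [p] is for the lower bound. In Q + Q^T - P^T Q the only coupling
     left is 2 <a, Ga A x>, absorbed by [Om] and the condition on [M]. *)
  + have [_ /(_ x)] := pd_psd Cpd; have := young_pd (A *m x - a) p Gapd.
    have := young_pd a (Ga *m (A *m x)) Ompd.
    have := pGai p; have := pOm a; have := pM x.
    have := pGa (A *m x); have := pGa a.
    rewrite !simp3 !expand -?mulmxA !dot_mulmxl ?nf !GaA AT [dot p a]dotC.
    by move=> *; split; lra.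
- case=> _ _ _.
  apply: forms3 => [|x y a b p q|x a p /=].
  + apply: ker3 => x a p; rewrite !simp3 -triple0 => /triple_inj[-> ->].
    by rewrite mulmx0 oppr0 add0r => ->.
  + by rewrite !simp3 !expand -?mulmxA !dot_mulmxl ?nf; ring.
  (* The square is for the lower bound; Q + Q^T - P^T Q is diag([M], [Om], [invmx Ga]). *)
  + have := young_pd a (- p) Gapd.
    have := pGai p; have := pOm a; have := pM x; have := pGa a.
    rewrite !simp3 !expand -?mulmxA !dot_mulmxl ?nf [dot p a]dotC.
    by move=> *; split; lra.
- case=> Mpd Ompd _ Cpd.
  have [sMi _] := pd_invmx Mpd; have uM := pd_unit Mpd.
  have [sOmi _] := pd_invmx Ompd; have uOm := pd_unit Ompd.
  have nf' := (sMi, sOmi, @mulKmx _ _ 1 _ uM, @mulKVmx _ _ 1 _ uM,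
    @mulKmx _ _ 1 _ uOm, @mulKVmx _ _ 1 _ uOm).
  apply: forms3 => [|x y a b p q|x a p /=].
  + apply: ker3 => x a p; rewrite !simp3 -triple0 => /triple_inj[xE aE pE].
    have Mx : M *m x = A^T *m p.
      by move/subr0_eq: xE => ->; rewrite -mulmxA mulKVmx.
    have Oma : Om *m a = - p.
      by rewrite -[a]opprK (addr0_eq aE) mulmxN mulKVmx.
    have Gap : invmx Ga *m p = a - A *m x.
      have -> : p = Ga *m (a - A *m x).
        rewrite -[LHS]subr0 -pE !opprD opprK addrC -addrA subrK addrC.
        by rewrite mulmxBr mulmxA.
      by rewrite mulKmx.
    (* On the kernel, <p, Ga^-1 p> equals - <a, Om a> - <x, M x>. Its nonnegativity forces [x = 0]
       and [a = 0], hence [p = 0]. *)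
    have := pGai p; rewrite Gap dotDr dotNr -AT -Mx.
    rewrite -[X in dot X a]opprK -Oma dotNl [dot _ a]dotC => le0.
    have x0 : x = 0.
      apply/eqP; apply: contraT => /(Mpd.2) px.
      by have := pOm a; lra.
    have a0 : a = 0.
      apply/eqP; apply: contraT => /(Ompd.2) pa.
      by have := pM x; lra.
    by split=> //; apply: oppr_inj; rewrite -Oma a0 mulmx0 oppr0.
  + by rewrite !simp3 !expand -?mulmxA !dot_mulmxl ?nf ?nf'; ring.
  (* Let z = A x - a. The form of P^T Q is the sum of the Young squares at (x, - A^T p), (a, p) and
     (z, p). The form of Q + Q^T - P^T Q is <x, M x> + <a, Om a> - <z, Ga z> plus the form of [C] at
     [p]; the instances at [Ga z] bound the third term by the first two. *)
  + have [_ C] := pd_psd Cpd; have := C p; have := C (Ga *m (A *m x - a)).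
    have := young_pd (A *m x - a) p Gapd.
    have := young_pd x (- (A^T *m (Ga *m (A *m x - a)))) Mpd.
    have := young_pd a (Ga *m (A *m x - a)) Ompd.
    have := young_pd x (- (A^T *m p)) Mpd; have := young_pd a p Ompd.
    rewrite !simp3 !expand -?mulmxA !dot_mulmxl ?nf ?nf' !GaA AT [dot p a]dotC.
    by move=> *; split; lra.
Qed.

End schemes.

(** * Subgradients, proximal points and Jensen's inequality *)

Section convex.
Context {R : realType} {n : nat}.
Variable phi : 'cV[R]_n -> \bar R.

Lemma subdiff_fin_num x v :
  Defs.proper phi -> subdiff phi x v -> phi x \is a fin_num.
Proof.
case=> phiN [z phiz] sx; rewrite fin_numE phiN /=.
apply: contra phiz => /eqP xy.
by have := sx z; rewrite xy addye // leye_eq.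
Qed.

Lemma argmin_fin_num (q : 'cV[R]_n -> R) u :
  Defs.proper phi -> argmin (fun v => (phi v + (q v)%:E)%E) u ->
  phi u \is a fin_num.
Proof.
case=> phiN [z phiz] /(_ z) uz; rewrite fin_numE phiN /=.
apply: contra phiz => /eqP uy; move: uz; rewrite uy addye // leye_eq.
by case: (phi z) (phiN z).
Qed.

(* The optimality inequality is tested along [u + t *: (y - u)] as [t]
   tends to 0. *)
Lemma prox_subdiff (B : 'M[R]_n) (w u : 'cV[R]_n) :
  Defs.proper phi -> convex_efun phi -> B^T = B -> proxP phi B w u ->
  subdiff phi u (w - B *m u).
Proof.
move=> pphi cphi sB pu y; have fu := argmin_fin_num pphi pu.
have [->|fy] := eqVneq (phi y) +oo%E; first by rewrite leey.
have {}fy : phi y \is a fin_num by rewrite fin_numE pphi.1.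
move: fu fy; case uE: (phi u) => [r| |] // _; case yE: (phi y) => [r'| |] // _.
have [e eE] : exists e, e = y - u by exists (y - u).
rewrite -eE -EFinD lee_fin.
pose D := r - r' + dot (w - B *m u) e.
have le_t t : 0 < t -> t <= 1 -> D <= t * (2^-1 * dot e (B *m e)).
  move=> t0 t1; have t01 : 0 <= t <= 1 by rewrite ltW.
  have := le_trans (pu _) (leeD2r _ (cphi y u t t01)).
  rewrite uE yE /= -!EFinM -!EFinD lee_fin.
  have -> : t *: y + (1 - t) *: u = u + t *: e.
    by apply/matrixP => i j; rewrite eE !mxE; ring.
  have eu : dot e (B *m u) = dot u (B *m e) by rewrite dotC dot_mulmxl sB.
  rewrite mulmxDr -scalemxAr !dotDl !dotDr !dotZl !dotZr eu => H.
  rewrite -(ler_pM2l t0) /D dotDl dotNl [dot (B *m u) e]dotC eu. lra.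
suff : D <= 0 by rewrite /D; lra.
rewrite leNgt; apply/negP => D0.
have := le_t 1 ltr01 (lexx 1); rewrite mul1r.
set K := 2^-1 * _ in le_t * => DK.
have K0 : 0 < K by apply: lt_le_trans DK.
have K2 : 0 < 2 * K by rewrite mulr_gt0.
(* At [t = D / (2 * K)], which is at most 1 since [D <= K], the bound reads [D <= D / 2],
   contradicting [0 < D]. *)
have := le_t _ (divr_gt0 D0 K2); rewrite ler_pdivrMr // => /(_ ltac:(lra)).
have -> : D / (2 * K) * K = D / 2 by field; rewrite gt_eqF.
by lra.
Qed.

(** Jensen's inequality by induction: the average of k + 2 points combines the average of the first
    k + 1, with weight (k + 1) / (k + 2), and the last point. Real majorants [r] keep the right-hand
    side finite. *)
Lemma ergodic_convex (u : nat -> 'cV[R]_n) (r : nat -> R) k :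
  convex_efun phi -> (0 < k)%N -> (forall i, (phi (u i) <= (r i)%:E)%E) ->
  (phi (ergodic u k) <= (k%:R^-1 * \sum_(0 <= i < k) r i)%:E)%E.
Proof.
move=> cphi; case: k => // k _ ur; elim: k => [|k IH].
  by rewrite /ergodic !big_nat1 invr1 scale1r mul1r.
pose t : R := k.+1%:R / k.+2%:R.
have k1 : k.+1%:R != 0 :> R by rewrite pnatr_eq0.
have k2 : k.+2%:R != 0 :> R by rewrite pnatr_eq0.
have t01 : 0 <= t <= 1.
  by rewrite divr_ge0 //= ler_pdivrMr ?ltr0n // mul1r ler_nat.
have t1E : 1 - t = k.+2%:R^-1.
  by rewrite /t -{1}(divff k2) -mulrBl -natrB // subSnn mul1r.
have tE : t * k.+1%:R^-1 = k.+2%:R^-1 by rewrite /t mulrAC divff // mul1r.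
have -> : ergodic u k.+2 = t *: ergodic u k.+1 + (1 - t) *: u k.+1.
  by rewrite /ergodic big_nat_recr //= scalerDr scalerA tE t1E.
apply: le_trans (cphi _ _ _ t01) _; clearbody t; case/andP: t01 => t0 t1.
rewrite big_nat_recr //= mulrDr -{1}tE -mulrA -t1E [leRHS]EFinD.
by apply: leeD; rewrite EFinM; apply: lee_wpmul2l; rewrite ?lee_fin ?subr_ge0.
Qed.

End convex.

(** * From the explicit updates to the generalized proximal point form *)

Section explicit.
Context {R : realType} {n m : nat}.
Variables (A : 'M[R]_(m, n)) (M : 'M[R]_n) (Om Ga : 'M[R]_m).
Variables (f : 'cV[R]_n -> \bar R) (g : 'cV[R]_m -> \bar R).

(** The proximal updates supply subgradients of [f] and [g] at the proximal output, the third row of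
    the relaxation determines [pt], and the inclusion becomes a linear identity. *)
Lemma explicit_gppa_step s c ct c' :
  proper_lsc_convex f -> proper_lsc_convex g -> lag_cond s A M Om Ga ->
  explicit_step s A M Om Ga f g c ct c' -> gppa_step s A M Om Ga f g c ct c'.
Proof.
case=> pf _ cf [pg _ cg] cond [up rel]; split=> //.
have [[sM _] [sOm _] Gapd] := lag_cond_psd cond.
have [sGa _] := pd_psd Gapd; have uGa := pd_unit Gapd.
have sMA : (M + A^T *m Ga *m A)^T = M + A^T *m Ga *m A.
  by rewrite linearD /= !trmx_mul trmxK sM sGa mulmxA.
have sOG : (Om + Ga)^T = Om + Ga by rewrite linearD /= sOm sGa.
move: up rel; rewrite -(triple_parts c) -(triple_parts ct) -(triple_parts c').
move: (xpart c) (apart c) (ppart c) => x a p.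
move: (xpart ct) (apart ct) (ppart ct) => xt at_ pt.
move: (xpart c') (apart c') (ppart c') => x' a' p'.
rewrite /lag_update /relaxation !xpart_triple !apart_triple !ppart_triple.
rewrite tripleN tripleD => up rel.
suff [u [t [su tt E]]] : exists u t, [/\ subdiff f xt u, subdiff g at_ t &
    triple (u + A^T *m pt) (t - pt) (- (A *m xt) + at_)
      + calQ s A M Om Ga *m triple (xt - x) (at_ - a) (pt - p) = 0].
  exists (triple (u + A^T *m pt) (t - pt) (- (A *m xt) + at_))=> //.
  by exists u, t; rewrite xpart_triple apart_triple ppart_triple.
have simp3 := (@block3_triple R n m, @tripleD R n m, @mul0mx R, @mul1mx R,
  @mulNmx R, @add0r, @addr0).
have expand := (@mulmxDl R, @mulmxDr R, @mulNmx R, @mulmxN R,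
  @mulKmx _ _ 1 _ uGa).
(* Vector identities are checked entrywise, where [lra] decides them. *)
have entryD k (u v : 'cV[R]_k) i j : (u + v) i j = u i j + v i j.
  by rewrite mxE.
have entryN k (u : 'cV[R]_k) i j : (- u) i j = - u i j by rewrite mxE.
have entryZ k (u : 'cV[R]_k) i j : (2 *: u) i j = 2 * u i j by rewrite mxE.
have entry0 k i j : (0 : 'cV[R]_k) i j = 0 by rewrite mxE.
have entry := (entryD, entryN, entryZ, entry0).
case: s cond up rel => /= cond up; rewrite ?simp3.
- case: up => /(prox_subdiff pf cf sM) fx /(prox_subdiff pg cg sOm) ga p'E.
  (* In the first six schemes the first two block rows of [calM] are those of the identity, so
     [x' = xt] and [a' = at_]. *)
  case/triple_inj=> /[!subrKC] x'E a'E pE; rewrite {}x'E {}a'E in fx ga p'E.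
  exists (M *m x - A^T *m p - M *m xt), (Om *m a + p - Om *m at_); split=> //.
  have ptE : pt = p + Ga *m (A *m (2 *: xt - x) - (2 *: at_ - a)).
    by rewrite -p'E.
  rewrite tripleD -triple0 ptE; congr triple; apply/matrixP => i j;
    rewrite ?expand -?mulmxA -?scalemxAr !entry; by clear; lra.
- case: up => /(prox_subdiff pf cf sMA) fx p'E /(prox_subdiff pg cg sOm) ga.
  case/triple_inj=> /[!subrKC] x'E a'E pE; rewrite {}x'E {}a'E in fx ga p'E.
  exists (M *m x + A^T *m Ga *m a - A^T *m p - (M + A^T *m Ga *m A) *m xt).
  exists (Om *m a + 2 *: p' - p - Om *m at_); split=> //.
  have ptE : pt = p + Ga *m (A *m xt - a) by rewrite -p'E.
  rewrite pE tripleD -triple0 ptE; congr triple; apply/matrixP => i j;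
    rewrite ?expand -?mulmxA -?scalemxAr !entry; by clear; lra.
- case: up => /(prox_subdiff pg cg sOm) ga /(prox_subdiff pf cf sMA) fx p'E.
  case/triple_inj=> /[!subrKC] x'E a'E pE; rewrite {}x'E {}a'E in fx ga p'E.
  exists (M *m x - A^T *m p + A^T *m Ga *m at_ - (M + A^T *m Ga *m A) *m xt).
  exists (Om *m a + p - Om *m at_); split=> //.
  (* Now [pt] differs from [p']: the relaxation subtracts [Ga *m (at_ - a)]. *)
  have ptE : pt = p + Ga *m (A *m xt - at_).
    apply/matrixP => i j; move/matrixP/(_ i j): pE; rewrite p'E.
    rewrite ?expand -?scalemxAr !entry; by clear; lra.
  rewrite tripleD -triple0 ptE; congr triple; apply/matrixP => i j;
    rewrite ?expand -?mulmxA -?scalemxAr !entry; by clear; lra.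
- case: up => /(prox_subdiff pf cf sM) fx /(prox_subdiff pg cg sOG) ga p'E.
  case/triple_inj=> /[!subrKC] x'E a'E pE; rewrite {}x'E {}a'E in fx ga p'E.
  exists (M *m x - A^T *m p - M *m xt).
  exists (Om *m a + Ga *m A *m xt + p - (Om + Ga) *m at_); split=> //.
  have ptE : pt = p + Ga *m (A *m xt - at_).
    apply/matrixP => i j; move/matrixP/(_ i j): pE; rewrite p'E.
    rewrite ?expand -?mulmxA -?scalemxAr !entry; by clear; lra.
  rewrite tripleD -triple0 ptE; congr triple; apply/matrixP => i j;
    rewrite ?expand -?mulmxA -?scalemxAr !entry; by clear; lra.
- case: up => /(prox_subdiff pf cf sMA) fx /(prox_subdiff pg cg sOG) ga p'E.
  case/triple_inj=> /[!subrKC] x'E a'E pE; rewrite {}x'E {}a'E in fx ga p'E.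
  exists (M *m x + A^T *m Ga *m a - A^T *m p - (M + A^T *m Ga *m A) *m xt).
  exists (Om *m a + Ga *m A *m x + p - (Om + Ga) *m at_); split=> //.
  have ptE : pt = p + Ga *m (A *m x - a).
    apply/matrixP => i j; move/matrixP/(_ i j): pE; rewrite p'E.
    rewrite ?expand -?mulmxA -?scalemxAr !entry; by clear; lra.
  rewrite tripleD -triple0 ptE; congr triple; apply/matrixP => i j;
    rewrite ?expand -?mulmxA -?scalemxAr !entry; by clear; lra.
- case: up => /(prox_subdiff pf cf sMA) fx /(prox_subdiff pg cg sOG) ga p'E.
  case/triple_inj=> /[!subrKC] x'E a'E pE; rewrite {}x'E {}a'E in fx ga p'E.
  exists (M *m x + A^T *m Ga *m a - A^T *m p - (M + A^T *m Ga *m A) *m xt).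
  exists (Om *m a + Ga *m A *m xt + p - (Om + Ga) *m at_); split=> //.
  have ptE : pt = p + Ga *m (A *m xt - a).
    apply/matrixP => i j; move/matrixP/(_ i j): pE; rewrite p'E.
    rewrite ?expand -?mulmxA -?scalemxAr !entry; by clear; lra.
  rewrite tripleD -triple0 ptE; congr triple; apply/matrixP => i j;
    rewrite ?expand -?mulmxA -?scalemxAr !entry; by clear; lra.
- case: up => /(prox_subdiff pf cf sM) fx /(prox_subdiff pg cg sOm) ga _ _ p'E.
  case/triple_inj=> _ _ pE.
  exists (M *m x - A^T *m p - M *m xt), (Om *m a + p - Om *m at_); split=> //.
  (* The proximal formulas are stated directly at [xt] and [at_]; solving the third row for [pt]
     leaves the residual at the old iterate. *)
  have ptE : pt = p + Ga *m (A *m x - a).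
    apply/matrixP => i j; move/matrixP/(_ i j): pE; rewrite p'E.
    rewrite ?expand -?mulmxA -?scalemxAr !entry; by clear; lra.
  rewrite tripleD -triple0 ptE; congr triple; apply/matrixP => i j;
    rewrite ?expand -?mulmxA -?scalemxAr !entry; by clear; lra.
Qed.

End explicit.

(** * Saddle points and the gap function *)

Section gap.
Context {R : realType} {n m : nat}.
Variables (f : 'cV[R]_n -> \bar R) (g : 'cV[R]_m -> \bar R) (A : 'M[R]_(m, n)).

Lemma zerA_saddle c : zerA f g A c ->
  [/\ subdiff f (xpart c) (- (A^T *m ppart c)), subdiff g (apart c) (ppart c)
    & A *m xpart c = apart c].
Proof.
case=> s [t [fs gt]]; rewrite -triple0 => /triple_inj[sE tE aE].
split; last by rewrite -[LHS]opprK (addr0_eq (esym aE)) // opprK.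
  by rewrite (addr0_eq (etrans (addrC _ _) (esym sE))).
by rewrite (subr0_eq (esym tE)) in gt.
Qed.

(** Feasibility of [cs] removes the coupling term of the second Lagrangian, so the gap does not
    depend on [ppart c]. *)
Lemma PiE c cs fx ga fs gs : A *m xpart cs = apart cs ->
  f (xpart c) = fx%:E -> g (apart c) = ga%:E ->
  f (xpart cs) = fs%:E -> g (apart cs) = gs%:E ->
  Pi f g A c cs =
    (fx + ga + dot (ppart cs) (A *m xpart c - apart c) - (fs + gs))%:E.
Proof.
by rewrite /Pi /lagrangian => -> -> -> -> ->; rewrite subrr dot0r addr0.
Qed.

Lemma subdiff_real k (phi : 'cV[R]_k -> \bar R) x y v a b :
  subdiff phi x v -> phi x = a%:E -> phi y = b%:E -> a + dot v (y - x) <= b.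
Proof. by move=> sx xE yE; have := sx y; rewrite xE yE -EFinD lee_fin. Qed.

(** The skew part of [calA], paired with [c - cs], collapses to <p*, A x - a> because [cs] is
    feasible; the rest is the two subgradient inequalities at [c], tested at [cs]. *)
Lemma calA_gap c cs v fx ga fs gs : calA f g A c v ->
  A *m xpart cs = apart cs ->
  f (xpart c) = fx%:E -> g (apart c) = ga%:E ->
  f (xpart cs) = fs%:E -> g (apart cs) = gs%:E ->
  fx + ga + dot (ppart cs) (A *m xpart c - apart c) - (fs + gs) <=
    dot v (c - cs).
Proof.
case=> s [t [fc gc ->]] Acs fE gE fsE gsE.
have := subdiff_real fc fE fsE; have := subdiff_real gc gE gsE.
have -> : c - cs = triple (xpart c - xpart cs) (apart c - apart cs)
    (ppart c - ppart cs).
  by rewrite -{1}(triple_parts c) -{1}(triple_parts cs) tripleN tripleD.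
rewrite dot_triple -Acs !dotE ![dot _ (ppart c)]dotC ![dot _ (ppart cs)]dotC.
rewrite !dot_mulmxl !trmxK.
by move=> *; lra.
Qed.

Lemma calA_fin_num c v : Defs.proper f -> Defs.proper g -> calA f g A c v ->
  f (xpart c) \is a fin_num /\ g (apart c) \is a fin_num.
Proof.
by move=> pf pg [s [t [fc gc _]]]; split;
  [exact: subdiff_fin_num fc|exact: subdiff_fin_num gc].
Qed.

End gap.

(** * The ergodic rate *)

Theorem theorem2 (R : realType) (n m : nat)
    (f : 'cV[R]_n -> \bar R) (g : 'cV[R]_m -> \bar R) (A : 'M[R]_(m, n))
    (M : 'M[R]_n) (Om Ga : 'M[R]_m) (s : lag_scheme)
    (c ct : nat -> 'cV[R]_(n + (m + m))) (cstar : 'cV[R]_(n + (m + m)))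
    (hf : proper_lsc_convex f) (hg : proper_lsc_convex g)
    (hcond : lag_cond s A M Om Ga)
    (hgen : generated_by s A M Om Ga f g c ct)
    (hstar : zerA f g A cstar)
    (k : nat) (hk : (1 <= k)%N) :
  (0%:E <= Pi f g A (ergodic ct k) cstar)%E /\
  (Pi f g A (ergodic ct k) cstar
     <= ((2 * k%:R)^-1 * snorm2 (calS s A M Om Ga) (c 0%N - cstar))%:E)%E.
Proof.
have [pf _ cf] := hf; have [pg _ cg] := hg.
have gppa i : gppa_step s A M Om Ga f g (c i) (ct i) (c i.+1).
  by case: hgen => // step; apply: explicit_gppa_step.
have [fstar gstar Astar] := zerA_saddle hstar.
have /fineK/esym fsE := subdiff_fin_num pf fstar.
have /fineK/esym gsE := subdiff_fin_num pg gstar.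
move: fsE gsE; set fs := fine (f _); set gs := fine (g _) => fsE gsE.
pose fr i := fine (f (xpart (ct i))); pose gr i := fine (g (apart (ct i))).
have frE i : f (xpart (ct i)) = (fr i)%:E.
  have [[v Av _] _] := gppa i; have [fx _] := calA_fin_num pf pg Av.
  by rewrite fineK.
have grE i : g (apart (ct i)) = (gr i)%:E.
  have [[v Av _] _] := gppa i; have [_ gx] := calA_fin_num pf pg Av.
  by rewrite fineK.
pose S := calS s A M Om Ga; have PC := lag_cond_prediction_correction hcond.
pose l i := dot (ppart cstar) (A *m xpart (ct i) - apart (ct i)).
(* The element of [calA] at [ct i] is [- (calQ *m (ct i - c i))], so the gap estimate chains with
   the descent estimate. *)
have step i : fr i + gr i + l i - (fs + gs) <=
    2^-1 * (snorm2 S (c i - cstar) - snorm2 S (c i.+1 - cstar)).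
  have [[v Av /eqP + rel]] := gppa i; rewrite addr_eq0 => /eqP vE.
  apply: le_trans (calA_gap Av Astar (frE i) (grE i) fsE gsE) _.
  by rewrite vE; apply: snorm2_descent.
have k0 : k%:R != 0 :> R by rewrite pnatr_eq0 -lt0n.
set X := ergodic ct k.
have fX : (f (xpart X) <= (k%:R^-1 * \sum_(0 <= i < k) fr i)%:E)%E.
  by rewrite xpart_ergodic; apply: ergodic_convex => // i; rewrite frE.
have gX : (g (apart X) <= (k%:R^-1 * \sum_(0 <= i < k) gr i)%:E)%E.
  by rewrite apart_ergodic; apply: ergodic_convex => // i; rewrite grE.
have lX : dot (ppart cstar) (A *m xpart X - apart X) =
    k%:R^-1 * \sum_(0 <= i < k) l i.
  rewrite xpart_ergodic apart_ergodic /ergodic -scalemxAr -scalerBr dotZr.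
  rewrite mulmx_sumr -sumrB; congr (_ * _).
  by elim/big_rec2: _ => [|i y z _ <-]; rewrite ?dot0r // dotDr.
(* Finiteness at the ergodic point comes from the Jensen upper bound and properness. *)
have fXfin : f (xpart X) \is a fin_num.
  by rewrite fin_numE pf.1 -ltey (le_lt_trans fX) ?ltey.
have gXfin : g (apart X) \is a fin_num.
  by rewrite fin_numE pg.1 -ltey (le_lt_trans gX) ?ltey.
move: fXfin gXfin => /fineK/esym fXE /fineK/esym gXE.
rewrite (PiE Astar fXE gXE fsE gsE) !lee_fin; split.
  (* The saddle subgradients - A^T p* and p* produce exactly the coupling term of the gap. *)
  have := subdiff_real fstar fsE fXE; have := subdiff_real gstar gsE gXE.
  rewrite -Astar !dotE !dot_mulmxl trmxK; lra.
move: fX gX; rewrite {1}fXE {1}gXE !lee_fin lX => fX gX.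
have sum_le : \sum_(0 <= i < k) (fr i + gr i + l i - (fs + gs)) <=
    2^-1 * snorm2 S (c 0%N - cstar).
  apply: le_trans (ler_sum _ (fun i _ => step i)) _.
  (* The sum telescopes; the final term - |c k - cstar|_S^2 is dropped by nonnegativity of the
     S-form. *)
  rewrite -mulr_sumr (telescope_sumr_eq (fun i => - snorm2 S (c i - cstar))) //.
    by have := snorm2_ge0 PC (c k - cstar); rewrite -/(calS s A M Om Ga) -/S;
      lra.
  by move=> i _; rewrite opprK addrC.
have kV : 0 <= k%:R^-1 :> R by rewrite invr_ge0.
have := ler_wpM2l kV sum_le.
rewrite sumrB sumr_const_nat subn0 -[(fs + gs) *+ k]mulr_natl !big_split /=.
rewrite mulrBr mulKf // !mulrDr invfM -/S [2^-1 / _]mulrC.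
rewrite -[_^-1 * 2^-1 * _]mulrA.
by lra.
Qed.
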